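(* Let $A\in\mathbb{R}^{n\times n}$ be symmetric, $N=n(n-1)/2$, and let $A_k=(\hat a^{(k)}_{ij})$ be the matrix $A_0=A$ after $k$ Jacobi updates in floating point arithmetic with the computed Jacobi rotations $\{\hat J_j=J(p_j,q_j;\hat c_j,\hat s_j)\}_{j=0}^{k-1}$ of the classical Jacobi method (at each step $j$ the pair $(p_j,q_j)$ is chosen so that $|\hat a^{(j)}_{p_jq_j}|=\max_{p\ne q}|\hat a^{(j)}_{pq}|$). If $2N\tilde\gamma_4<1$, then for any $k\ge 0$, $$\|\mathrm{off}(A_{k+1})\|_F^2\le c\,\|\mathrm{off}(A_k)\|_F^2+2\|G_k\|_F^2\,\tilde\gamma_4^2,$$ where $c=1-1/N+2\tilde\gamma_4\in(0,1)$. Moreover, for any $k\ge 1$ there exists some ordering $\{\lambda_{\pi^{(0)}(i)}(A_0)\}_{i=1}^n$ of the eigenvalues $\{\lambda_i(A_0)\}_{i=1}^n$ (i.e. a permutation $\pi^{(0)}$ of $\{1,\dots,n\}$) such that $$\Big(\sum_{i=1}^n\big(\hat a^{(k)}_{ii}-\lambda_{\pi^{(0)}(i)}(A_0)\big)^2\Big)^{1/2}\le\|\mathrm{off}(A_k)\|_F+\tilde\gamma_4\sum_{j=0}^{k-1}\varphi_j,$$ where $\varphi_j=\big((6+4\sqrt2)\|G_j\|_F^2+2\|H_j\|_F^2\big)^{1/2}$ for $j=0,1,\dots,k-1$.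
   Context: Notation: $\|\cdot\|_F$ is the Frobenius norm; $\mathrm{off}(G)=G-\mathrm{diag}(g_{11},\dots,g_{nn})$; eigenvalues of a symmetric matrix $G$ are $\lambda_1(G)\ge\dots\ge\lambda_n(G)$. Floating point model with unit roundoff $u$: $\mathrm{fl}(x\,\mathrm{op}\,y)=(x\,\mathrm{op}\,y)(1+\delta_1)=(x\,\mathrm{op}\,y)/(1+\delta_2)$, $|\delta_1|,|\delta_2|\le u$, $\mathrm{op}\in\{+,-,*,/\}$; $\mathrm{fl}(\sqrt x)=\sqrt x(1+\delta)$, $|\delta|\le u$. $\tilde\gamma_j:=(1-u)^{-wj}-1$, where $w>0$ is a fixed small integer constant (not depending on the matrix, its order, or $u$) whose exact value is unimportant. Jacobi rotation: for $p<q$ and $c^2+s^2=1$ (exact rotations), $J(p,q;c,s)$ is the identity matrix except that its $(p,p)$ and $(q,q)$ entries are $c$, its $(p,q)$ entry is $s$, its $(q,p)$ entry is $-s$; the same notation is used with computed $\hat c,\hat s$. The exact Jacobi rotation for a symmetric $A$ and the pair $(p,q)$ has $c=(1+t^2)^{-1/2}$, $s=tc$, with $t=1/(\mu+\sqrt{1+\mu^2})$ if $\mu\ge0$, $t=1/(\mu-\sqrt{1+\mu^2})$ if $\mu<0$, $\mu=(a_{qq}-a_{pp})/(2a_{pq})$, and $(c,s)=(1,0)$ if $a_{pq}=0$; it makes the $(p,q)$ entry of $J^TAJ$ zero. One floating point step in the $(p,q)$ plane on the symmetric matrix $A_k=(\hat a^{(k)}_{ij})$: $J_k=J(p,q;c_k,s_k)$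 denotes the exact Jacobi rotation for $A_k$ and $(p,q)$, and $\hat J_k=J(p,q;\hat c_k,\hat s_k)$ the one computed in floating point, which satisfies $\hat c_k=c_k(1+\theta)$, $\hat s_k=s_k(1+\theta')$ with $|\theta|,|\theta'|\le\tilde\gamma_1$. The computed symmetric matrix $A_{k+1}$ agrees with $A_k$ outside rows and columns $p,q$, and (superscript $(k)$ and subscript $k$ dropped on the right) $\hat a^{(k+1)}_{pj}=\mathrm{fl}(\hat c\hat a_{pj}-\hat s\hat a_{qj})$, $\hat a^{(k+1)}_{qj}=\mathrm{fl}(\hat s\hat a_{pj}+\hat c\hat a_{qj})$ for $j\ne p,q$, $\hat a^{(k+1)}_{pp}=\mathrm{fl}(\hat c(\hat c\hat a_{pp}-\hat s\hat a_{pq})-\hat s(\hat c\hat a_{pq}-\hat s\hat a_{qq}))$, $\hat a^{(k+1)}_{pq}=\mathrm{fl}(\hat s(\hat c\hat a_{pp}-\hat s\hat a_{pq})+\hat c(\hat c\hat a_{pq}-\hat s\hat a_{qq}))$, and $\hat a^{(k+1)}_{qq}$ is computed analogously to $\hat a^{(k+1)}_{pp}$. $G_k$: symmetric $n\times n$ matrix, zero except that its entries at the intersections of rows and columns $p,q$ (positions $(p,p),(p,q),(q,p),(q,q)$) equal those of $A_k$. $H_k$: symmetric $n\times n$ matrix, zero except that $(H_k)_{pj}=(H_k)_{jp}=\hat a^{(k)}_{pj}$ and $(H_k)_{qj}=(H_k)_{jq}=\hat a^{(k)}_{qj}$ for all $j\ne p,q$. Here $(p,q)=(p_k,q_k)$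 is the pair used at step $k$. *)

(* Defs.v *)
From HB Require Import structures.
From mathcomp Require Import all_boot all_order all_algebra.
From mathcomp Require Import perm reals.
From mathcomp Require Import polyrcf.
Set Implicit Arguments.
Unset Strict Implicit.
Unset Printing Implicit Defensive.
Import Order.TTheory GRing.Theory Num.Theory.
Local Open Scope ring_scope.

Section MatrixNotions.
Variables (R : realType) (n : nat).
Implicit Types (A G : 'M[R]_n) (p q : 'I_n).

Definition normF G : R := Num.sqrt (\sum_i \sum_j G i j ^+ 2).

Definition off G : 'M[R]_n := G - diag_mx (\row_i G i i).

(* The real eigenvalues of A, with algebraic multiplicity, in nonincreasing
   order.  If A is symmetric, then char_poly A splits over R, so that this
   sequence has size n. *)
Definition eigseq A : seq R :=
  sort >=%R (flatten [seq nseq (mup x (char_poly A)) x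
                     | x <- rootsR (char_poly A)]).

(* lambda_(i+1)(A): ordinals start at 0 *)
Definition eigval A (i : 'I_n) : R := nth 0 (eigseq A) i.

Definition Gmx A p q : 'M[R]_n :=
  \matrix_(i, j) if (i \in [:: p; q]) && (j \in [:: p; q]) then A i j else 0.

(* exactly one of the two indices lies in {p, q} *)
Definition Hmx A p q : 'M[R]_n :=
  \matrix_(i, j) if (i \in [:: p; q]) (+) (j \in [:: p; q]) then A i j else 0.

Definition phi A p q : R :=
  Num.sqrt ((6 + 4 * Num.sqrt 2) * normF (Gmx A p q) ^+ 2
            + 2 * normF (Hmx A p q) ^+ 2).

Definition max_pivot A p q : Prop :=
  (p < q)%N /\ forall i j : 'I_n, i != j -> `|A i j| <= `|A p q|.

Definition jacobi_mu A p q : R := (A q q - A p p) / (2 * A p q).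

Definition jacobi_t A p q : R :=
  let mu := jacobi_mu A p q in
  if 0 <= mu then (mu + Num.sqrt (1 + mu ^+ 2))^-1
  else (mu - Num.sqrt (1 + mu ^+ 2))^-1.

Definition jacobi_c A p q : R :=
  if A p q == 0 then 1 else (Num.sqrt (1 + jacobi_t A p q ^+ 2))^-1.

Definition jacobi_s A p q : R :=
  if A p q == 0 then 0 else jacobi_t A p q * jacobi_c A p q.

End MatrixNotions.

Section FloatingPoint.
Variable R : realType.
Implicit Types (u x y z : R) (w j : nat).

Definition fl_approx u x y : Prop :=
  (exists2 d1 : R, `|d1| <= u & y = x * (1 + d1)) /\
  (exists2 d2 : R, `|d2| <= u & y = x / (1 + d2)).

Record fl_model u := FlModel {
  fl_add : R -> R -> R;
  fl_sub : R -> R -> R;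
  fl_mul : R -> R -> R;
  fl_div : R -> R -> R;
  fl_sqrt : R -> R;
  fl_addP : forall x y, fl_approx u (x + y) (fl_add x y);
  fl_subP : forall x y, fl_approx u (x - y) (fl_sub x y);
  fl_mulP : forall x y, fl_approx u (x * y) (fl_mul x y);
  fl_divP : forall x y, y != 0 -> fl_approx u (x / y) (fl_div x y);
  fl_sqrtP : forall x, 0 <= x ->
    exists2 d : R, `|d| <= u & fl_sqrt x = Num.sqrt x * (1 + d)
}.

Definition gammat w u j : R := (1 - u) ^- (w * j) - 1.

Definition computed_rotation w u n (A : 'M[R]_n) (p q : 'I_n) (ch sh : R)
    : Prop :=
  (exists2 th : R, `|th| <= gammat w u 1 & ch = jacobi_c A p q * (1 + th)) /\
  (exists2 th : R, `|th| <= gammat w u 1 & sh = jacobi_s A p q * (1 + th)).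

Section Update.
Variables (u : R) (fl : fl_model u).
Let add := fl_add fl.
Let sub := fl_sub fl.
Let mul := fl_mul fl.
Variables (n : nat) (A : 'M[R]_n) (p q : 'I_n) (ch sh : R).

Definition upd_pj (j : 'I_n) := sub (mul ch (A p j)) (mul sh (A q j)).
Definition upd_qj (j : 'I_n) := add (mul sh (A p j)) (mul ch (A q j)).

Definition upd_pp :=
  sub (mul ch (sub (mul ch (A p p)) (mul sh (A p q))))
      (mul sh (sub (mul ch (A p q)) (mul sh (A q q)))).
Definition upd_pq :=
  add (mul sh (sub (mul ch (A p p)) (mul sh (A p q))))
      (mul ch (sub (mul ch (A p q)) (mul sh (A q q)))).
Definition upd_qq :=
  add (mul sh (add (mul sh (A p p)) (mul ch (A p q))))
      (mul ch (add (mul sh (A p q)) (mul ch (A q q)))).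

Definition fl_update : 'M[R]_n :=
  \matrix_(i, j)
    if i == p then
      if j == p then upd_pp else if j == q then upd_pq else upd_pj j
    else if i == q then
      if j == p then upd_pq else if j == q then upd_qq else upd_qj j
    else if j == p then upd_pj i
    else if j == q then upd_qj i
    else A i j.

End Update.
End FloatingPoint.

(* A_0 = A, A_1, A_2, ... produced by the classical Jacobi method in floating
   point arithmetic, with pivot pairs (p k, q k) and computed rotations
   (ch k, sh k) *)
Record classical_jacobi (R : realType) (w : nat) (u : R) (fl : fl_model u)
    (n : nat) (A : 'M[R]_n) (Ak : nat -> 'M[R]_n) (p q : nat -> 'I_n)
    (ch sh : nat -> R) : Prop := ClassicalJacobi {
  cj_init : Ak 0%N = A;
  cj_pivot : forall k, max_pivot (Ak k) (p k) (q k);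
  cj_rotation : forall k,
    computed_rotation w u (Ak k) (p k) (q k) (ch k) (sh k);
  cj_update : forall k,
    Ak k.+1 = fl_update fl (Ak k) (p k) (q k) (ch k) (sh k)
}.

(* Main.v *)
Require Import Defs.
From mathcomp Require Import all_boot all_order all_algebra.
From mathcomp Require Import perm reals.
From mathcomp Require Import polyrcf complex spectral.
From mathcomp Require Import ring lra zify.
Import Order.TTheory GRing.Theory Num.Theory.
Local Open Scope ring_scope.

Set Implicit Arguments.
Unset Strict Implicit.
Unset Printing Implicit Defensive.

(** Both claims come from comparing one computed step B with the exact rotation
    T = J^T A J by the exact Jacobi rotation J of the pivot.  Every computed
    entry is a sum of products of entries of A with one or two computed rotation
    coefficients, so its error is at most (1 - u)^-m - 1 times the same sum taken
    with absolute values.  Here m = w + 2 for an entry of rows p, q that is moved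
    by one side of the rotation only, and m = 2 w + 4 for the three entries of the
    pivot block.  For w >= 2 the second count, which is twice the first, is at
    most 4 w.  So w0 = 2 works, g4 bounds every error, and 1 + g4 even dominates
    the square of the largest growth factor (1 - u)^-(w + 2) of the first kind.

    Off-diagonal norm ([update_off]).  The exact rotation annihilates the pivot,
    so the computed pivot is pure rounding error, bounded by g4 times the norm of
    the block G ([update_block_error]).  In the rest of rows p, q the exact
    rotation preserves norms, and rounding multiplies the squared norm by at most
    1 + 2 g4 ([rot_row_growth]).  Since the pivot is the largest off-diagonal
    entry in modulus, removing it lowers the squared off-norm by a fraction at
    least 1 / N.

    Eigenvalues.  The same entrywise bounds give |B - T|_F <= g4 phi
    ([update_error]).  By orthogonal invariance of the Frobenius norm the errors
    add up along the iteration, so A_k is within g4 times the sum of the phi_j of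
    some Q^T A_0 Q with Q orthogonal ([iterate_near_similar]).  The diagonal part
    of A_k then differs from Q^T A_0 Q by at most |off(A_k)|_F more, and the case
    of the Hoffman-Wielandt inequality in which one matrix is diagonal
    ([hoffman_wielandt_diag]) pairs the diagonal entries with the eigenvalues.

    That inequality reduces to a rearrangement inequality: if U is the unitary
    matrix that diagonalizes a symmetric matrix, its diagonal entries are averages
    of its eigenvalues l_k with weights S_ki = |U_ki|^2, and S is doubly
    stochastic.  The sum of S_ij d_i l_j is largest when S matches both families
    in sorted order, which is proved by an explicit dual certificate
    ([abel_potential]) in place of Birkhoff's theorem. *)

(** * Eigenvalues and the spectral decomposition of a symmetric matrix *)

Lemma char_poly_conj (F : fieldType) n (P Q A : 'M[F]_n) :
  P *m Q = 1%:M -> char_poly (P *m A *m Q) = char_poly A.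
Proof.
move=> PQ.
have PQX : map_mx polyC P *m map_mx polyC Q = 1%:M by rewrite -map_mxM PQ map_mx1.
have -> : char_poly (P *m A *m Q) =
    \det (map_mx polyC P *m char_poly_mx A *m map_mx polyC Q).
  rewrite /char_poly /char_poly_mx mulmxBr mulmxBl !map_mxM /=.
  by rewrite scalar_mxC -(mulmxA 'X%:M) PQX mulmx1.
rewrite (@det_mulmx {poly F}) (@det_mulmx {poly F}) mulrAC.
by rewrite -(@det_mulmx {poly F}) PQX det1 mul1r.
Qed.

(** Once the characteristic polynomial splits, the list of its roots repeated by
    multiplicity is any list of linear factors, up to order: both lists count x
    as often as its multiplicity. *)
Lemma perm_eigseq (R : realType) n (A : 'M[R]_n) (s : seq R) :
  char_poly A = \prod_(x <- s) ('X - x%:P) -> perm_eq s (eigseq A).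
Proof.
move=> As; rewrite /eigseq perm_sym perm_sort.
have p0 : char_poly A != 0 by rewrite monic_neq0 // char_poly_monic.
apply/allP => x _ /=; apply/eqP.
rewrite count_flatten -map_comp.
rewrite (eq_map (g := fun y => (mup y (char_poly A) * (y == x))%N)); last first.
  by move=> y /=; rewrite count_nseq mulnC.
rewrite sumnE big_map.
have rE := roots_on_rootsR p0 x.
have [xr|xNr] := boolP (x \in rootsR (char_poly A)).
  rewrite (bigD1_seq x) ?uniq_roots //= eqxx muln1 big1 ?addn0.
    by rewrite As mu_prod_XsubC.
  by move=> y /negPf ->; rewrite muln0.
rewrite big_seq big1 => [|y ys]; last first.
  by case: eqP => [yx|]; rewrite ?muln0 // -yx ys in xNr *.
apply/esym; rewrite -mu_prod_XsubC -As mupNroot //.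
by move: rE; rewrite (negPf xNr) inE /= => ->.
Qed.

(** The spectral theorem in the only form needed for the Hoffman-Wielandt
    inequality.  B is diagonalized over the complex numbers by a unitary U, with
    real eigenvalues l because B is Hermitian; then S_ki = |U_ki|^2 is real and
    doubly stochastic, and U itself can be forgotten. *)
Lemma symmetric_spectral (R : realType) n (B : 'M[R]_n) : B^T = B ->
  exists (S : 'M[R]_n) (l : 'I_n -> R),
  [/\ forall i j, 0 <= S i j,
      forall i, \sum_j S i j = 1,
      forall j, \sum_i S i j = 1 &
      [/\ char_poly B = \prod_(i < n) ('X - (l i)%:P),
      forall i, B i i = \sum_k S k i * l k &
      \sum_i \sum_j B i j ^+ 2 = \sum_k l k ^+ 2]].
Proof.
move=> Bsym; pose f : {rmorphism R -> R[i]} := real_complex R; pose M := map_mx f B.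
have Bs i j : B i j = B j i by rewrite -{1}Bsym mxE.
have Mre : M \is a mxOver Num.real.
  by apply/mxOverP => i j; rewrite mxE complex_real.
have Msym : M \is symmetricmx.
  by apply/is_hermitianmxP; rewrite expr0 scale1r; apply/matrixP=> i j; rewrite !mxE /= Bs.
have Mh := realsym_hermsym Msym Mre.
pose U := spectralmx M; pose d := spectral_diag M.
have Uu : U \is unitarymx := spectral_unitarymx M.
have dre : d \is a mxOver Num.real := hermitian_spectral_diag_real Mh.
have ME : M = invmx U *m diag_mx d *m U.
  exact/orthomx_spectralP/hermitian_normalmx.
pose l i := complex.Re (d 0 i).
have dE i : d 0 i = f (l i).
  by apply/esym/RRe_real; exact: (mxOverP dre).
have fI : injective f by exact: complexI.
pose S := \matrix_(i, j) (complex.Re (U i j) ^+ 2 + complex.Im (U i j) ^+ 2) : 'M[R]_n.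
have SE i j : f (S i j) = U i j * (U i j)^*.
  by rewrite mxE -normCK; exact: add_Re2_Im2.
exists S, l; split.
- by move=> i j; rewrite mxE addr_ge0 ?sqr_ge0.
- move=> i; apply: fI; rewrite rmorph_sum rmorph1.
  have /unitarymxP/matrixP/(_ i i) := Uu; rewrite !mxE eqxx mulr1n => <-.
  by apply: eq_bigr => j _; rewrite SE !mxE.
- move=> j; apply: fI; rewrite rmorph_sum rmorph1.
  have /mulmx1C/matrixP/(_ j j) : U *m U ^t* %sesqui = 1%:M by apply/unitarymxP.
  rewrite !mxE eqxx mulr1n => <-.
  by apply: eq_bigr => i _; rewrite SE !mxE mulrC.
have UV : invmx U *m U = 1%:M by rewrite mulVmx ?unitarymx_unit.
split.
- apply: (map_poly_inj f).
  rewrite map_char_poly -/M ME char_poly_conj // char_poly_trig ?diag_mx_is_trig //.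
  rewrite rmorph_prod; apply: eq_bigr => i _.
  by rewrite rmorphB /= map_polyX map_polyC /= mxE eqxx mulr1n -dE.
- move=> i; apply: fI; rewrite rmorph_sum.
  have -> : f (B i i) = M i i by rewrite mxE.
  rewrite ME mxE; apply: eq_bigr => k _.
  rewrite mul_mx_diag mxE rmorphM SE -dE invmx_unitary // !mxE; ring.
apply: fI; rewrite !rmorph_sum.
have -> : \sum_i f (\sum_j B i j ^+ 2) = \tr (M *m M).
  apply: eq_bigr => i _; rewrite mxE rmorph_sum; apply: eq_bigr => j _.
  by rewrite !mxE (Bs j i) expr2 rmorphM.
rewrite ME !mulmxA -(mulmxA _ U (invmx U)) mulmxV ?unitarymx_unit // mulmx1.
rewrite mxtrace_mulC !mulmxA mulmxV ?unitarymx_unit // mul1mx.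
apply: eq_bigr => i _; rewrite mul_diag_mx !mxE eqxx mulr1n dE expr2 rmorphM.
by rewrite /=.
Qed.

(** * A rearrangement inequality for doubly stochastic weights *)

(** The dual variable of the assignment problem with gains D_i L_j: with v this
    function, D_i L_j <= (D_i L_i - v_i) + v_j, with equality at j = i.  Its
    increment at j is D_j (L_(j+1) - L_j). *)
Definition abel_potential (R : realFieldType) (D L : nat -> R) (j : nat) : R :=
  \sum_(0 <= m < j) D m * (L m.+1 - L m).

(** Both sides are sums of multiples of L_(m+1) - L_m over m between i and j, with
    factor D_i on the left and D_m on the right.  The increments of L are nonpositive, and D_m
    is on the favourable side of D_i whether j lies after or before i. *)
Lemma abel_potential_ge (R : realFieldType) n (D L : nat -> R) i j :
    (forall a b, (a <= b < n)%N -> D b <= D a) ->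
    (forall a b, (a <= b < n)%N -> L b <= L a) ->
    (i < n)%N -> (j < n)%N ->
  D i * (L j - L i) <= abel_potential D L j - abel_potential D L i.
Proof.
move=> Ddec Ldec iltn jltn.
have vB a b : (a <= b)%N -> abel_potential D L b - abel_potential D L a =
    \sum_(a <= m < b) D m * (L m.+1 - L m).
  move=> leab; rewrite /abel_potential (big_cat_nat (n := a)) //=.
  by rewrite addrAC subrr add0r.
have Ltele a b : (a <= b)%N ->
    D i * (L b - L a) = \sum_(a <= m < b) D i * (L m.+1 - L m).
  by move=> leab; rewrite -mulr_sumr telescope_sumr.
have [leij|/ltnW leji] := leqP i j.
  rewrite vB // Ltele // ler_sum_nat // => m /andP[im mj].
  have mn := leq_ltn_trans mj jltn.
  have dm : D m <= D i by rewrite Ddec // im (ltnW mn).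
  have lm : L m.+1 <= L m by rewrite Ldec // leqnSn mn.
  nra.
rewrite -opprB mulrN -[leRHS]opprB lerN2 vB // Ltele //.
rewrite ler_sum_nat // => m /andP[jm mi].
have mn := leq_ltn_trans mi iltn.
have dm : D i <= D m by rewrite Ddec // (ltnW mi).
have lm : L m.+1 <= L m by rewrite Ldec // leqnSn mn.
nra.
Qed.

(** Weak duality: the gain D_i L_j is bounded by a function of i plus a function
    of j, and averaging such a sum with doubly stochastic weights does not depend
    on the weights.  The bound is attained by the identity matrix. *)
Lemma rearrangement_doubly_stochastic (R : realFieldType) n
    (S : 'I_n -> 'I_n -> R) (D L : nat -> R) :
    (forall a b, (a <= b < n)%N -> D b <= D a) ->
    (forall a b, (a <= b < n)%N -> L b <= L a) ->
    (forall i j, 0 <= S i j) ->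
    (forall i, \sum_j S i j = 1) -> (forall j, \sum_i S i j = 1) ->
  \sum_i \sum_j S i j * (D i * L j) <= \sum_(i < n) D i * L i.
Proof.
move=> Ddec Ldec S0 Srow Scol.
pose v := abel_potential D L.
have -> : \sum_(i < n) D i * L i =
    \sum_i \sum_j S i j * (D i * L i - v i + v j).
  under [RHS]eq_bigr => i _.
    under eq_bigr => j _ do rewrite mulrDr.
    rewrite big_split /= -mulr_suml Srow mul1r.
    over.
  rewrite big_split /= [X in _ = _ + X]exchange_big /=.
  under [X in _ = _ + X]eq_bigr => j _ do rewrite -mulr_suml Scol mul1r.
  by rewrite sumrB subrK.
apply: ler_sum => i _; apply: ler_sum => j _; apply: ler_wpM2l => //.
have := abel_potential_ge Ddec Ldec (ltn_ord i) (ltn_ord j).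
rewrite -/v; lra.
Qed.

Lemma perm_eq_reindex (R : realType) n (s : seq R) (f : 'I_n -> R) :
  perm_eq s [seq f i | i <- enum 'I_n] ->
  exists t : 'S_n, forall i : 'I_n, nth 0 s i = f (t i).
Proof.
move=> sf; have : perm_eq s [tuple f i | i < n] by [].
case/tuple_permP => t st; exists t => i.
by rewrite st -tnth_nth !tnth_mktuple.
Qed.

Lemma nth_sorted_ge (R : realType) (s : seq R) a b : sorted >=%R s ->
  (a <= b < size s)%N -> nth 0 s b <= nth 0 s a.
Proof.
move=> ss /andP[ab bs].
have ge_trans : transitive (>=%R : rel R).
  by move=> x y z yx zx; apply: le_trans yx.
apply: (sorted_leq_nth ge_trans _ 0 ss) => //; last exact: leq_ltn_trans bs.
by move=> x; exact: lexx.
Qed.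

(** Expanding the squares, the terms free of the pairing are the same on both
    sides, so the claim compares the inner product of d and the diagonal of B
    with that of d and the eigenvalues.  The permutation pairs the i-th largest
    entry of d with the i-th largest eigenvalue. *)
Lemma hoffman_wielandt_diag (R : realType) n (B : 'M[R]_n) (d : 'I_n -> R) :
  B^T = B ->
  exists t : 'S_n, \sum_i (d i - eigval B (t i)) ^+ 2 <=
    \sum_i \sum_j (diag_mx (\row_k d k) i j - B i j) ^+ 2.
Proof.
move=> Bsym; have [S [l [S0 Srow Scol [Bchar Bdiag Bsq]]]] := symmetric_spectral Bsym.
have ge_tot : total (>=%R : rel R) by move=> x y; exact: le_total.
have el : perm_eq (eigseq B) [seq l i | i <- enum 'I_n].
  by rewrite perm_sym perm_eigseq // big_map big_enum.
have [tl tlE] := perm_eq_reindex el.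
pose ds := sort >=%R [seq d i | i <- enum 'I_n].
have [td tdE] : exists t : 'S_n, forall i : 'I_n, nth 0 ds i = d (t i).
  by apply: perm_eq_reindex; rewrite perm_sort.
have Ddec a b : (a <= b < n)%N -> nth 0 ds b <= nth 0 ds a.
  move=> ab; apply: nth_sorted_ge; first exact: sort_sorted.
  by rewrite size_sort size_map size_enum_ord.
have Ldec a b : (a <= b < n)%N -> nth 0 (eigseq B) b <= nth 0 (eigseq B) a.
  move=> ab; apply: nth_sorted_ge; first exact: sort_sorted.
  by rewrite (perm_size el) size_map size_enum_ord.
have key : \sum_i d i * B i i <= \sum_(i < n) nth 0 ds i * nth 0 (eigseq B) i.
  rewrite (le_trans _ (rearrangement_doubly_stochastic
    (S := fun i j => S (tl j) (td i)) Ddec Ldec _ _ _)) //.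
  - rewrite (reindex_inj (@perm_inj _ td)) /= ler_sum // => i _.
    rewrite Bdiag (reindex_inj (@perm_inj _ tl)) mulr_sumr ler_sum // => j _.
    by rewrite tdE tlE mulrCA.
  - by move=> i; rewrite -(Scol (td i)) [RHS](reindex_inj (@perm_inj _ tl)).
  - by move=> j; rewrite -(Srow (tl j)) [RHS](reindex_inj (@perm_inj _ td)).
exists td^-1%g.
have -> : \sum_i (d i - eigval B ((td^-1)%g i)) ^+ 2 =
    \sum_i d i ^+ 2 + \sum_k l k ^+ 2
    - 2 * \sum_(i < n) nth 0 ds i * nth 0 (eigseq B) i.
  rewrite [X in _ = X + _ - _](reindex_inj (@perm_inj _ td)).
  rewrite [X in _ = _ + X - _](reindex_inj (@perm_inj _ tl)).
  rewrite [LHS](reindex_inj (@perm_inj _ td)) mulr_sumr -big_split -sumrB.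
  apply: eq_bigr => i _; rewrite /= permK /eigval tdE tlE; ring.
have -> : \sum_i \sum_j (diag_mx (\row_k d k) i j - B i j) ^+ 2 =
    \sum_i d i ^+ 2 + \sum_k l k ^+ 2 - 2 * \sum_i d i * B i i.
  rewrite -Bsq mulr_sumr -big_split -sumrB; apply: eq_bigr => i _ /=.
  rewrite (bigD1 i) //= [in RHS](bigD1 i) //= !mxE eqxx mulr1n.
  rewrite (eq_bigr (fun j => B i j ^+ 2)); first by ring.
  by move=> j /negPf ji; rewrite !mxE eq_sym ji mulr0n sub0r sqrrN.
lra.
Qed.

(** * The Frobenius norm *)

Section Frobenius.
Variables (R : realType) (n : nat).
Implicit Types A B Q : 'M[R]_n.

Lemma sym_entry A i j : A^T = A -> A i j = A j i.
Proof. by move=> As; rewrite -{1}As mxE. Qed.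

Lemma normF_ge0 A : 0 <= normF A. Proof. exact: sqrtr_ge0. Qed.

Lemma sqr_normF A : normF A ^+ 2 = \sum_i \sum_j A i j ^+ 2.
Proof.
by rewrite sqr_sqrtr // !sumr_ge0 // => i _; rewrite sumr_ge0 // => j _; exact: sqr_ge0.
Qed.

Lemma normF_orthoconj Q A : Q^T *m Q = 1%:M -> normF (Q^T *m A *m Q) = normF A.
Proof.
move=> QQ; rewrite /normF; congr Num.sqrt.
have frob B : \sum_i \sum_j B i j ^+ 2 = \tr (B *m B^T).
  by apply: eq_bigr => i _; rewrite mxE; apply: eq_bigr => j _; rewrite mxE expr2.
rewrite !frob !trmx_mul trmxK !mulmxA -(mulmxA _ Q Q^T) (mulmx1C QQ) mulmx1.
by rewrite mxtrace_mulC !mulmxA (mulmx1C QQ) mul1mx.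
Qed.

Lemma normF_triangle A B : normF (A + B) <= normF A + normF B.
Proof.
rewrite -(ler_pXn2r (ltn0Sn 1)) ?nnegrE ?addr_ge0 ?normF_ge0 //.
have [a0 b0] := (normF_ge0 A, normF_ge0 B).
have sumE (X : 'M[R]_n) : normF X ^+ 2 = \sum_(u : 'I_n * 'I_n) X u.1 u.2 ^+ 2.
  by rewrite sqr_normF pair_bigA.
pose s := \sum_(u : 'I_n * 'I_n) A u.1 u.2 * B u.1 u.2.
(* Lagrange's identity: the Gram defect is half a sum of squares. *)
have CS : s ^+ 2 <= normF A ^+ 2 * normF B ^+ 2.
  have : 0 <= \sum_(u : 'I_n * 'I_n) \sum_(v : 'I_n * 'I_n)
      (A u.1 u.2 * B v.1 v.2 - A v.1 v.2 * B u.1 u.2) ^+ 2.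
    by apply: sumr_ge0 => u _; apply: sumr_ge0 => v _; exact: sqr_ge0.
  have -> : \sum_(u : 'I_n * 'I_n) \sum_(v : 'I_n * 'I_n)
      (A u.1 u.2 * B v.1 v.2 - A v.1 v.2 * B u.1 u.2) ^+ 2 =
      2 * (normF A ^+ 2 * normF B ^+ 2 - s ^+ 2).
    have prodE f g : (\sum_(u : 'I_n * 'I_n) f u) * (\sum_(v : 'I_n * 'I_n) g v) =
        \sum_u \sum_v f u * g v :> R.
      by rewrite mulr_suml; apply: eq_bigr => u _; rewrite mulr_sumr.
    rewrite mulrBr [2 * (normF A ^+ 2 * _)]mulr_natl mulr2n {2}[normF A ^+ 2 * _]mulrC.
    rewrite !sumE expr2.
    rewrite !prodE !mulr_sumr -big_split -sumrB; apply: eq_bigr => u _.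
    rewrite !mulr_sumr -big_split -sumrB; apply: eq_bigr => v _ /=; ring.
  by rewrite pmulr_rge0 // subr_ge0.
have sle : s <= normF A * normF B.
  rewrite (le_trans (ler_norm _)) // -(ler_pXn2r (ltn0Sn 1)) ?nnegrE ?mulr_ge0 //.
  by rewrite real_normK ?num_real // exprMn.
have -> : normF (A + B) ^+ 2 = normF A ^+ 2 + normF B ^+ 2 + 2 * s.
  rewrite !sumE mulr_sumr -!big_split; apply: eq_bigr => u _ /=.
  rewrite !mxE; ring.
nra.
Qed.

(** A rotation in the (p, q) plane treats separately the pivot block, the rest of
    rows and columns p, q, and everything else; all norm estimates below are made
    on these three parts. *)
Lemma sum_plane_split (f : 'I_n -> 'I_n -> R) (p q : 'I_n) :
    p != q -> (forall i j, f i j = f j i) ->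
  \sum_i \sum_j f i j =
  f p p + f q q + 2 * f p q
  + 2 * \sum_(j | (j != p) && (j != q)) (f p j + f q j)
  + \sum_(i | (i != p) && (i != q)) \sum_(j | (j != p) && (j != q)) f i j.
Proof.
move=> pq fC.
have split1 (g : 'I_n -> R) :
    \sum_j g j = g p + g q + \sum_(j | (j != p) && (j != q)) g j.
  by rewrite (bigD1 p) //= (bigD1 q) //= 1?eq_sym // addrA.
rewrite split1 /= (split1 (f p)) (split1 (f q)).
under eq_bigr => i _ do rewrite split1.
rewrite !big_split /= (fC q p).
rewrite [\sum_(i | _) f i p](eq_bigr (f p)) => [|i _]; last exact: fC.
rewrite [\sum_(i | _) f i q](eq_bigr (f q)) => [|i _]; last exact: fC.
ring.
Qed.

Lemma sqr_normF_Gmx A p q : A^T = A -> p != q ->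
  normF (Gmx A p q) ^+ 2 = A p p ^+ 2 + A q q ^+ 2 + 2 * A p q ^+ 2.
Proof.
move=> As pq; have AC i j := sym_entry i j As.
rewrite sqr_normF (sum_plane_split pq) => [|i j]; last first.
  by rewrite !mxE andbC AC.
rewrite !mxE !inE !eqxx ?orbT /= big1 ?mulr0 => [|j /andP[/negPf jp /negPf jq]].
  rewrite big1 ?addr0 // => i /andP[/negPf ip /negPf iq].
  by apply: big1 => j _; rewrite mxE !inE ip iq expr0n.
by rewrite !mxE !inE jp jq !andbF expr0n addr0.
Qed.

Lemma sqr_normF_Hmx A p q : A^T = A -> p != q ->
  normF (Hmx A p q) ^+ 2 =
  2 * \sum_(j | (j != p) && (j != q)) (A p j ^+ 2 + A q j ^+ 2).
Proof.
move=> As pq; have AC i j := sym_entry i j As.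
rewrite sqr_normF (sum_plane_split pq) => [|i j]; last first.
  by rewrite !mxE addbC AC.
rewrite !mxE !inE !eqxx ?orbT /= expr0n /= mulr0 !addr0 add0r.
rewrite [X in _ + X]big1 ?addr0 => [|i /andP[/negPf ip /negPf iq]].
  congr (2 * _); apply: eq_bigr => j /andP[/negPf jp /negPf jq].
  by rewrite !mxE !inE jp jq !eqxx ?orbT.
by apply: big1 => j /andP[/negPf jp /negPf jq]; rewrite mxE !inE ip iq jp jq expr0n.
Qed.

Lemma off_entry A i j : off A i j = if i == j then 0 else A i j.
Proof. by rewrite !mxE; case: eqP => [->|_]; rewrite ?mulr1n ?subrr ?mulr0n ?subr0. Qed.

Lemma sqr_normF_off A p q : A^T = A -> p != q ->
  normF (off A) ^+ 2 = 2 * A p q ^+ 2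
  + 2 * \sum_(j | (j != p) && (j != q)) (A p j ^+ 2 + A q j ^+ 2)
  + \sum_(i | (i != p) && (i != q)) \sum_(j | (j != p) && (j != q)) off A i j ^+ 2.
Proof.
move=> As pq; have AC i j := sym_entry i j As.
rewrite sqr_normF (sum_plane_split pq) => [|i j]; last first.
  by rewrite !off_entry eq_sym AC.
rewrite !off_entry !eqxx (negPf pq) expr0n /= !add0r.
congr (_ + 2 * _ + _); apply: eq_bigr => j /andP[/negPf jp /negPf jq].
by rewrite !off_entry eq_sym jp eq_sym jq.
Qed.

End Frobenius.

(** * The exact Jacobi rotation *)

Section ExactRotation.
Variables (R : realType) (n : nat) (A : 'M[R]_n) (p q : 'I_n).
Let c := jacobi_c A p q.
Let s := jacobi_s A p q.

Lemma jacobi_cs : c ^+ 2 + s ^+ 2 = 1.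
Proof.
rewrite /c /s /jacobi_s /jacobi_c; case: ifP => _; first by rewrite expr0n expr1n addr0.
set t := jacobi_t A p q; have t1 : 0 < 1 + t ^+ 2 by have := sqr_ge0 t; lra.
rewrite exprMn -[X in X + _]mul1r -mulrDl exprVn sqr_sqrtr ?ltW //.
by rewrite divff // gt_eqF.
Qed.

(** Both cases of the definition of t are 1 / x for a root x of
    x^2 = 2 mu x + 1; dividing that equation by x^2 gives the claim. *)
Lemma jacobi_t_quadratic :
  1 - jacobi_t A p q ^+ 2 - 2 * jacobi_mu A p q * jacobi_t A p q = 0.
Proof.
rewrite /jacobi_t; set m := jacobi_mu A p q; set r := Num.sqrt (1 + m ^+ 2).
have m2 := sqr_ge0 m.
have r2 : r ^+ 2 = 1 + m ^+ 2 by rewrite sqr_sqrtr //; lra.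
have r0 : 0 < r by rewrite sqrtr_gt0; lra.
have inv x : x != 0 -> x ^+ 2 = 2 * m * x + 1 -> 1 - x^-1 ^+ 2 - 2 * m * x^-1 = 0.
  move=> x0 xE.
  have -> : 1 - x^-1 ^+ 2 - 2 * m * x^-1 = (x ^+ 2 - 1 - 2 * m * x) / x ^+ 2 by field.
  by rewrite [X in X / _](_ : _ = 0) ?mul0r // xE; ring.
case: ifP => [m0|/negbT m0]; apply: inv.
- by apply: lt0r_neq0; lra.
- by rewrite sqrrD r2; ring.
- by rewrite -ltNge in m0; apply: ltr0_neq0; lra.
- by rewrite sqrrB r2; ring.
Qed.

(** The left-hand side is c^2 a_pq (1 - t^2 - 2 mu t). *)
Lemma jacobi_annihilates :
  s * (c * A p p - s * A p q) + c * (c * A p q - s * A q q) = 0.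
Proof.
rewrite /c /s /jacobi_s /jacobi_c; have [->|apq] := eqVneq (A p q) 0; first by ring.
set t := jacobi_t A p q; set c' := (Num.sqrt _)^-1.
have muE : 2 * jacobi_mu A p q * A p q = A q q - A p p.
  by rewrite /jacobi_mu; field.
have -> : t * c' * (c' * A p p - t * c' * A p q) + c' * (c' * A p q - t * c' * A q q)
   = c' ^+ 2 * (A p q * (1 - t ^+ 2) - t * (A q q - A p p)) by ring.
rewrite -muE [X in _ * X](_ : _ = A p q * (1 - t ^+ 2 - 2 * jacobi_mu A p q * t)).
  by rewrite jacobi_t_quadratic !mulr0.
ring.
Qed.

End ExactRotation.

Section PlaneRotation.
Variables (R : realType) (n : nat) (p q : 'I_n) (c s : R).
Hypothesis pq : p != q.

Definition plane_rot : 'M[R]_n := \matrix_(i, j)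
  if i == p then (if j == p then c else if j == q then s else 0)
  else if i == q then (if j == p then - s else if j == q then c else 0)
  else (i == j)%:R.

(** The action of the transposed rotation on a column f; a two-sided rotation
    applies it once along rows and once along columns. *)
Definition rot_comb (f : 'I_n -> R) (i : 'I_n) : R :=
  if i == p then c * f p - s * f q
  else if i == q then s * f p + c * f q else f i.

Lemma sum_plane_rot (f : 'I_n -> R) i :
  \sum_l plane_rot l i * f l = rot_comb f i.
Proof.
have qp : (q == p) = false by rewrite eq_sym (negPf pq).
rewrite (bigD1 p) //= (bigD1 q) ?qp //= !mxE !eqxx qp /rot_comb.
have [->|ip] := eqVneq i p.
  rewrite big1 => [|l /andP[/negPf lp /negPf lq]]; first by ring.
  by rewrite mxE lp lq mul0r.
have [->|iq] := eqVneq i q.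
  rewrite big1 => [|l /andP[/negPf lp /negPf lq]]; first by ring.
  by rewrite mxE lp lq mul0r.
rewrite (bigD1 i) ?ip //= big1 => [|l /andP[/andP[/negPf lp /negPf lq] /negPf li]].
  by rewrite mxE (negPf ip) (negPf iq) eqxx mulr1n; ring.
by rewrite mxE lp lq li mul0r.
Qed.

Lemma plane_rot_conjE (A : 'M[R]_n) i j :
  (plane_rot^T *m A *m plane_rot) i j =
  rot_comb (fun m => rot_comb (fun l => A l m) i) j.
Proof.
rewrite -sum_plane_rot mxE; apply: eq_bigr => m _; rewrite mulrC.
congr (_ * _); rewrite -sum_plane_rot mxE; apply: eq_bigr => l _.
by rewrite mxE.
Qed.

Lemma plane_rot_ortho : c ^+ 2 + s ^+ 2 = 1 -> plane_rot^T *m plane_rot = 1%:M.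
Proof.
move=> cs; apply/matrixP => i j; rewrite !mxE.
under eq_bigr => l _ do rewrite mxE.
rewrite sum_plane_rot /rot_comb !mxE !eqxx (eq_sym q p) (negPf pq).
have [->|ip] := eqVneq i p.
  rewrite (eq_sym p j); have [_|jp] := eqVneq j p; first by rewrite -[RHS]cs; ring.
  by have [_|jq] := eqVneq j q; rewrite mulr0n; ring.
have [->|iq] := eqVneq i q.
  have [->|jp] := eqVneq j p; first by rewrite eq_sym (negPf pq) mulr0n; ring.
  rewrite (eq_sym q j).
  by have [_|jq] := eqVneq j q; [rewrite -[RHS]cs|rewrite mulr0n]; ring.
by [].
Qed.

End PlaneRotation.

(** * A calculus of accumulated rounding errors *)

Section RoundingErrors.
Variable R : realType.
Variable u : R.
Hypotheses (u0 : 0 < u) (u1 : u < 1).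

(** The bound for m accumulated rounding errors; [gammat w u j] is
    [gam u (w * j)] by conversion. *)
Definition gam (m : nat) : R := (1 - u) ^- m - 1.

Lemma gam0 : gam 0 = 0. Proof. by rewrite /gam expr0 invr1 subrr. Qed.

(** This multiplicativity is why errors are measured by powers of 1 / (1 - u):
    the counts of rounding errors simply add. *)
Lemma gamD m l : 1 + gam (m + l) = (1 + gam m) * (1 + gam l).
Proof. by rewrite /gam !subrKC exprD invfM. Qed.

Lemma gam1 : u <= gam 1.
Proof.
rewrite /gam lerBrDr expr1 -[leRHS]mul1r ler_pdivlMr ?subr_gt0 //.
have := sqr_ge0 u; rewrite expr2; lra.
Qed.

Lemma gam_ge0 m : 0 <= gam m.
Proof.
rewrite /gam subr_ge0 invf_ge1 ?exprn_gt0 ?subr_gt0 //.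
by apply: exprn_ile1; rewrite ?subr_ge0 ?gerBl ltW.
Qed.

Lemma gam_le m l : (m <= l)%N -> gam m <= gam l.
Proof.
move=> /subnKC <-; have := gamD m (l - m); have := gam_ge0 m; have := gam_ge0 (l - m).
nra.
Qed.

(** z approximates x up to m rounding errors, where v stands for the expression
    x with all its terms replaced by their absolute values.  A plain relative
    error would not survive cancellation; an error relative to v is stable under
    both products and sums. *)
Definition apx m (x v z : R) := `|z - x| <= gam m * v /\ `|x| <= v.

Lemma apx_exact x : apx 0 x `|x| x.
Proof. by split => //; rewrite subrr normr0 gam0 mul0r. Qed.

Lemma apx_le m l x v z : (m <= l)%N -> apx m x v z -> apx l x v z.
Proof.
move=> ml [zx xv]; split=> //; apply: le_trans zx _.
by rewrite ler_wpM2r ?gam_le // (le_trans _ xv).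
Qed.

Lemma apx_mul m l x v z y w z' :
  apx m x v z -> apx l y w z' -> apx (m + l) (x * y) (v * w) (z * z').
Proof.
move=> [zx xv] [zy yw]; split; last by rewrite normrM ler_pM.
have -> : z * z' - x * y = x * (z' - y) + (z - x) * y + (z - x) * (z' - y) by ring.
have -> : gam (m + l) * (v * w) =
    v * (gam l * w) + gam m * v * w + gam m * v * (gam l * w).
  have := gamD m l; move=> /(congr1 (fun x => x - 1)); rewrite addrAC subrr add0r => ->.
  ring.
rewrite (le_trans (ler_normD _ _)) // lerD ?normrM ?ler_pM //.
by rewrite (le_trans (ler_normD _ _)) // lerD ?normrM ?ler_pM.
Qed.

Lemma apx_add m x v z y w z' :
  apx m x v z -> apx m y w z' -> apx m (x + y) (v + w) (z + z').
Proof.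
move=> [zx xv] [zy yw]; split; last by rewrite (le_trans (ler_normD _ _)) // lerD.
rewrite [X in `|X|](_ : _ = (z - x) + (z' - y)); last by ring.
by rewrite mulrDr (le_trans (ler_normD _ _)) // lerD.
Qed.

Lemma apx_sub m x v z y w z' :
  apx m x v z -> apx m y w z' -> apx m (x - y) (v + w) (z - z').
Proof.
move=> ax [zy yw]; apply: apx_add => //; split; last by rewrite normrN.
by rewrite -opprD normrN.
Qed.

Lemma apx_fl m x v z z' : apx m x v z -> fl_approx u z z' -> apx m.+1 x v z'.
Proof.
move=> ax [[d du ->] _].
have ad : apx 1 1 1 (1 + d).
  by split; rewrite ?normr1 // addrAC subrr add0r mulr1 (le_trans du) ?gam1.
by have := apx_mul ax ad; rewrite addn1 !mulr1.
Qed.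

Lemma apx_computed w x th : `|th| <= gam w -> apx w x `|x| (x * (1 + th)).
Proof.
move=> thw; split=> //.
by rewrite mulrDr mulr1 addrAC subrr add0r normrM mulrC ler_wpM2r.
Qed.

End RoundingErrors.

(** * Scalar estimates for one rotated pair and for the pivot block *)

(** The cross terms contribute 4 |c s x y|, and 2 |c s| <= 1 while
    2 |x y| <= x^2 + y^2. *)
Lemma abs_rot_le (R : realFieldType) (c s x y : R) : c ^+ 2 + s ^+ 2 = 1 ->
  (`|c| * `|x| + `|s| * `|y|) ^+ 2 + (`|s| * `|x| + `|c| * `|y|) ^+ 2
  <= 2 * (x ^+ 2 + y ^+ 2).
Proof.
rewrite -(real_normK (num_real c)) -(real_normK (num_real s)).
rewrite -(real_normK (num_real x)) -(real_normK (num_real y)).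
have := (normr_ge0 c, normr_ge0 s, normr_ge0 x, normr_ge0 y).
move: `|c| `|s| `|x| `|y| => {}c {}s {}x {}y [[[c0 s0] x0] y0] cs.
have -> : (c * x + s * y) ^+ 2 + (s * x + c * y) ^+ 2 =
  (c ^+ 2 + s ^+ 2) * (x ^+ 2 + y ^+ 2) + 4 * (c * s) * (x * y) by ring.
have cs2 : 2 * (c * s) <= 1 by have := sqr_ge0 (c - s); rewrite sqrrB; lra.
have xy2 : 2 * (x * y) <= x ^+ 2 + y ^+ 2 by have := sqr_ge0 (x - y); rewrite sqrrB; lra.
have : 0 <= x * y by exact: mulr_ge0.
rewrite cs; nra.
Qed.

Lemma rot_row_error (R : realFieldType) (c s x y g z1 z2 : R) :
  c ^+ 2 + s ^+ 2 = 1 -> 0 <= g ->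
  `|z1 - (c * x - s * y)| <= g * (`|c| * `|x| + `|s| * `|y|) ->
  `|z2 - (s * x + c * y)| <= g * (`|s| * `|x| + `|c| * `|y|) ->
  (z1 - (c * x - s * y)) ^+ 2 + (z2 - (s * x + c * y)) ^+ 2
    <= 2 * g ^+ 2 * (x ^+ 2 + y ^+ 2).
Proof.
move=> cs g0 h1 h2; have := abs_rot_le x y cs.
move: h1 h2; set r1 := z1 - (c * x - s * y); set r2 := z2 - (s * x + c * y) => h1 h2.
have sq r v : `|r| <= g * v -> r ^+ 2 <= g ^+ 2 * v ^+ 2.
  move=> rv; rewrite -exprMn -(real_normK (num_real r)).
  by rewrite ler_pXn2r ?nnegrE // (le_trans _ rv).
move=> v12; have := sq _ _ h1; have := sq _ _ h2; have := sqr_ge0 g; nra.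
Qed.

(** The exact pair (e1, e2) has the same length as (x, y).  Each cross term
    2 e r, with |r| <= g v, is at most g (e^2 + v^2); summing and using
    [abs_rot_le] for v gives 3 g.  The sharper 2 sqrt 2 g is not worth its square
    root, since the factor only has to stay below 2 (1 + g)^2 - 1. *)
Lemma rot_row_growth (R : realFieldType) (c s x y g z1 z2 : R) :
  c ^+ 2 + s ^+ 2 = 1 -> 0 <= g ->
  `|z1 - (c * x - s * y)| <= g * (`|c| * `|x| + `|s| * `|y|) ->
  `|z2 - (s * x + c * y)| <= g * (`|s| * `|x| + `|c| * `|y|) ->
  z1 ^+ 2 + z2 ^+ 2 <= (1 + 3 * g + 2 * g ^+ 2) * (x ^+ 2 + y ^+ 2).
Proof.
move=> cs g0 h1 h2; have r12 := rot_row_error cs g0 h1 h2.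
have := abs_rot_le x y cs.
move: h1 h2 r12; set v1 := `|c| * `|x| + `|s| * `|y|; set v2 := `|s| * `|x| + `|c| * `|y|.
set e1 := c * x - s * y; set e2 := s * x + c * y.
have eE : e1 ^+ 2 + e2 ^+ 2 = x ^+ 2 + y ^+ 2.
  by rewrite -[RHS]mul1r -cs /e1 /e2; ring.
set r1 := z1 - e1; set r2 := z2 - e2 => h1 h2 r12 v12.
have -> : z1 ^+ 2 + z2 ^+ 2 =
  (e1 ^+ 2 + e2 ^+ 2) + (2 * (e1 * r1) + 2 * (e2 * r2)) + (r1 ^+ 2 + r2 ^+ 2).
  by rewrite /r1 /r2; ring.
have cross e r v : `|r| <= g * v -> 2 * (e * r) <= g * (e ^+ 2 + v ^+ 2).
  move=> rv; have : e * r <= g * (`|e| * v).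
    rewrite (le_trans (ler_norm _)) // normrM.
    by rewrite [leRHS]mulrCA ler_wpM2l.
  have -> : e ^+ 2 = `|e| ^+ 2 by rewrite real_normK ?num_real.
  have := sqr_ge0 (`|e| - v); nra.
have := cross e1 _ _ h1; have := cross e2 _ _ h2.
rewrite eE; nra.
Qed.

(** Cauchy-Schwarz in the norm of the pivot block, whose off-diagonal entry y
    occurs twice; this weights be^2 by 1 / 2. *)
Lemma block_cauchy_schwarz (R : realFieldType) (al be ga x y z : R) :
  (al * x + be * y + ga * z) ^+ 2 <=
  (al ^+ 2 + be ^+ 2 / 2 + ga ^+ 2) * (x ^+ 2 + z ^+ 2 + 2 * y ^+ 2).
Proof.
have h1 := sqr_ge0 (al * z - ga * x).
have h2 := sqr_ge0 (2 * al * y - be * x).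
have h3 := sqr_ge0 (2 * ga * y - be * z).
rewrite -subr_ge0; move: h1 h2 h3; set X := _ ^+ 2; set Y := _ ^+ 2; set Z := _ ^+ 2.
move=> h1 h2 h3.
suff -> : (al ^+ 2 + be ^+ 2 / 2 + ga ^+ 2) * (x ^+ 2 + z ^+ 2 + 2 * y ^+ 2) -
  (al * x + be * y + ga * z) ^+ 2 = X + Y / 2 + Z / 2 by lra.
by rewrite /X /Y /Z; field.
Qed.

Lemma block_error (R : realFieldType) (al be ga x y z g e : R) :
  0 <= g -> al ^+ 2 + be ^+ 2 / 2 + ga ^+ 2 <= 1 ->
  `|e| <= g * (al * x + be * y + ga * z) ->
  e ^+ 2 <= g ^+ 2 * (x ^+ 2 + z ^+ 2 + 2 * y ^+ 2).
Proof.
move=> g0 n1 he; have := block_cauchy_schwarz al be ga x y z => cs.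
have e2 : e ^+ 2 <= g ^+ 2 * (al * x + be * y + ga * z) ^+ 2.
  rewrite -exprMn -(real_normK (num_real e)).
  by rewrite ler_pXn2r ?nnegrE // (le_trans _ he).
apply: le_trans e2 _; rewrite ler_wpM2l ?sqr_ge0 //.
apply: le_trans cs _; rewrite -[leRHS]mul1r ler_wpM2r //.
by have := (sqr_ge0 x, sqr_ge0 y, sqr_ge0 z) => -[[]]; lra.
Qed.

(** * One computed step compared with the exact rotation *)

Section Step.
Variables (R : realType) (u : R) (fl : fl_model u) (w n : nat).
Hypotheses (u0 : 0 < u) (u1 : u < 1) (w2 : (2 <= w)%N).
Variables (A : 'M[R]_n) (p q : 'I_n) (ch sh : R).
Hypotheses (As : A^T = A) (pq : p != q).
Hypothesis rot : computed_rotation w u A p q ch sh.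

Let c := jacobi_c A p q.
Let s := jacobi_s A p q.
Let B := fl_update fl A p q ch sh.
Let T := (plane_rot p q c s)^T *m A *m plane_rot p q c s.
Let g2 := gam u (w + 2).
Let g4 := gam u (w * 4).

Let cs : c ^+ 2 + s ^+ 2 = 1 := jacobi_cs A p q.

Lemma apx_ch : apx u w c `|c| ch.
Proof. by case: rot => -[th thw ->] _; apply: apx_computed; rewrite -[w]muln1. Qed.

Lemma apx_sh : apx u w s `|s| sh.
Proof. by case: rot => _ [th thw ->]; apply: apx_computed; rewrite -[w]muln1. Qed.

Lemma apx_fl_mul m l x v z y v' z' : apx u m x v z -> apx u l y v' z' ->
  apx u (m + l).+1 (x * y) (v * v') (fl_mul fl z z').
Proof. by move=> ax ay; apply: apx_fl (fl_mulP fl _ _) => //; apply: apx_mul. Qed.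

Lemma apx_fl_add m x v z y v' z' : apx u m x v z -> apx u m y v' z' ->
  apx u m.+1 (x + y) (v + v') (fl_add fl z z').
Proof. by move=> ax ay; apply: apx_fl (fl_addP fl _ _) => //; apply: apx_add. Qed.

Lemma apx_fl_sub m x v z y v' z' : apx u m x v z -> apx u m y v' z' ->
  apx u m.+1 (x - y) (v + v') (fl_sub fl z z').
Proof. by move=> ax ay; apply: apx_fl (fl_subP fl _ _) => //; apply: apx_sub. Qed.

Lemma apx_inner_sub x y : apx u (w + 2) (c * x - s * y)
  (`|c| * `|x| + `|s| * `|y|) (fl_sub fl (fl_mul fl ch x) (fl_mul fl sh y)).
Proof.
rewrite addn2 -[in X in apx _ X](addn0 w).
by apply: apx_fl_sub; apply: apx_fl_mul (apx_exact _ _); [exact: apx_ch|exact: apx_sh].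
Qed.

Lemma apx_inner_add x y : apx u (w + 2) (s * x + c * y)
  (`|s| * `|x| + `|c| * `|y|) (fl_add fl (fl_mul fl sh x) (fl_mul fl ch y)).
Proof.
rewrite addn2 -[in X in apx _ X](addn0 w).
by apply: apx_fl_add; apply: apx_fl_mul (apx_exact _ _); [exact: apx_sh|exact: apx_ch].
Qed.

(* This count of rounding errors, like 2 (w + 2) <= 4 w below, forces w >= 2. *)
Let le_2w4_4w : ((w + (w + 2)).+2 <= w * 4)%N. Proof. lia. Qed.

Lemma apx_outer_sub x1 v1 z1 x2 v2 z2 :
  apx u (w + 2) x1 v1 z1 -> apx u (w + 2) x2 v2 z2 ->
  apx u (w * 4) (c * x1 - s * x2) (`|c| * v1 + `|s| * v2)
    (fl_sub fl (fl_mul fl ch z1) (fl_mul fl sh z2)).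
Proof.
move=> a1 a2; apply: (apx_le u0 u1 le_2w4_4w).
by apply: apx_fl_sub; apply: apx_fl_mul => //; [exact: apx_ch|exact: apx_sh].
Qed.

Lemma apx_outer_add x1 v1 z1 x2 v2 z2 :
  apx u (w + 2) x1 v1 z1 -> apx u (w + 2) x2 v2 z2 ->
  apx u (w * 4) (s * x1 + c * x2) (`|s| * v1 + `|c| * v2)
    (fl_add fl (fl_mul fl sh z1) (fl_mul fl ch z2)).
Proof.
move=> a1 a2; apply: (apx_le u0 u1 le_2w4_4w).
by apply: apx_fl_add; apply: apx_fl_mul => //; [exact: apx_sh|exact: apx_ch].
Qed.

Let qp : (q == p) = false. Proof. by rewrite eq_sym (negPf pq). Qed.

Lemma fl_update_sym : B^T = B.
Proof.
rewrite /B; apply/matrixP => i j; rewrite !mxE.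
case: (eqVneq i p) => _; case: (eqVneq j p) => _ //.
case: (eqVneq i q) => _; case: (eqVneq j q) => _ //.
exact: sym_entry.
Qed.

Lemma rotated_sym : T^T = T.
Proof. by rewrite /T !trmx_mul trmxK As mulmxA. Qed.

Lemma update_outside i j : i != p -> i != q -> j != p -> j != q -> B i j = T i j.
Proof.
move=> ip iq jp jq; rewrite /B /T plane_rot_conjE // /rot_comb !mxE.
by rewrite !(negPf ip) !(negPf iq) !(negPf jp) !(negPf jq).
Qed.

Lemma rotated_row j : j != p -> j != q ->
  T p j = c * A p j - s * A q j /\ T q j = s * A p j + c * A q j.
Proof.
move=> jp jq; rewrite /T !plane_rot_conjE // /rot_comb.
by rewrite !(negPf jp) !(negPf jq) !eqxx qp.
Qed.

(** An entry in row p or q outside the block involves one rotation coefficient per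
    term, one product and one sum, hence w + 2 rounding errors. *)
Lemma update_row_error j : j != p -> j != q ->
  `|B p j - T p j| <= g2 * (`|c| * `|A p j| + `|s| * `|A q j|) /\
  `|B q j - T q j| <= g2 * (`|s| * `|A p j| + `|c| * `|A q j|).
Proof.
move=> jp jq; have [-> ->] := rotated_row jp jq.
rewrite /B !mxE !eqxx !(negPf jp) !(negPf jq) qp.
by split; [have [] := apx_inner_sub (A p j) (A q j)
  |have [] := apx_inner_add (A p j) (A q j)].
Qed.

Let Aqp : A q p = A p q. Proof. exact: sym_entry. Qed.

Lemma rotated_block :
  [/\ T p p = c * (c * A p p - s * A p q) - s * (c * A p q - s * A q q),
      T p q = s * (c * A p p - s * A p q) + c * (c * A p q - s * A q q) &
      T q q = s * (s * A p p + c * A p q) + c * (s * A p q + c * A q q)].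
Proof. by split; rewrite /T plane_rot_conjE // /rot_comb ?qp !eqxx ?qp Aqp. Qed.

Lemma rotated_pivot : T p q = 0.
Proof. by have [_ -> _] := rotated_block; exact: jacobi_annihilates. Qed.

Let G2 := normF (Gmx A p q) ^+ 2.

Let cs2 : 2 * (`|s| * `|c|) <= 1.
Proof.
have := sqr_ge0 (`|s| - `|c|); rewrite sqrrB !real_normK ?num_real // => h.
by move: cs; lra.
Qed.

(** The coefficients of |a_pp|, |a_pq|, |a_qq| are c^2, 2 |s c|, s^2 for the
    diagonal entries, whose weighted squared length is (c^2 + s^2)^2 = 1, and
    |s c|, 1, |s c| for the pivot, where it is 2 s^2 c^2 + 1 / 2 <= 1. *)
Lemma update_block_error :
  [/\ (B p p - T p p) ^+ 2 <= g4 ^+ 2 * G2,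
      (B p q - T p q) ^+ 2 <= g4 ^+ 2 * G2 &
      (B q q - T q q) ^+ 2 <= g4 ^+ 2 * G2].
Proof.
have [-> -> ->] := rotated_block.
have g40 : 0 <= g4 by exact: gam_ge0.
have cn : `|c| ^+ 2 = c ^+ 2 by rewrite real_normK ?num_real.
have sn : `|s| ^+ 2 = s ^+ 2 by rewrite real_normK ?num_real.
rewrite /G2 sqr_normF_Gmx // -(real_normK (num_real (A p p))).
rewrite -(real_normK (num_real (A q q))) -(real_normK (num_real (A p q))).
rewrite /B !mxE !eqxx qp /upd_pp /upd_pq /upd_qq.
have c4 : (c ^+ 2) ^+ 2 + (2 * (`|s| * `|c|)) ^+ 2 / 2 + (s ^+ 2) ^+ 2 <= 1.
  rewrite -cn -sn; have -> : (`|c| ^+ 2) ^+ 2 + (2 * (`|s| * `|c|)) ^+ 2 / 2 + (`|s| ^+ 2) ^+ 2 =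
    (`|c| ^+ 2 + `|s| ^+ 2) ^+ 2 by field.
  by rewrite cn sn cs expr1n.
split.
- have [e _] := apx_outer_sub (apx_inner_sub (A p p) (A p q)) (apx_inner_sub (A p q) (A q q)).
  apply: (block_error g40 c4); apply: le_trans e _; rewrite -cn -sn le_eqVlt.
  by apply/orP; left; apply/eqP; congr (_ * _); ring.
- have [e _] := apx_outer_add (apx_inner_sub (A p p) (A p q)) (apx_inner_sub (A p q) (A q q)).
  apply: (@block_error _ (`|s| * `|c|) 1 (`|s| * `|c|)) => //.
    by have := mulr_ge0 (normr_ge0 s) (normr_ge0 c); have := cs2; nra.
  apply: le_trans e _; rewrite -[1 * `|A p q|](_ : (`|c| ^+ 2 + `|s| ^+ 2) * `|A p q| = _).
    by rewrite le_eqVlt; apply/orP; left; apply/eqP; congr (_ * _); ring.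
  by rewrite cn sn cs.
have [e _] := apx_outer_add (apx_inner_add (A p p) (A p q)) (apx_inner_add (A p q) (A q q)).
apply: (@block_error _ (s ^+ 2) (2 * (`|s| * `|c|)) (c ^+ 2)) => //.
  by rewrite addrC [(s ^+ 2) ^+ 2 + _]addrC addrA.
apply: le_trans e _; rewrite -cn -sn le_eqVlt.
by apply/orP; left; apply/eqP; congr (_ * _); ring.
Qed.

(** The four block entries contribute at most 4 |G|^2 g4^2, and the rest of rows and
    columns p, q at most 2 |H|^2 g4^2; every other entry is exact. *)
Lemma update_error : normF (B - T) <= g4 * phi A p q.
Proof.
have g40 : 0 <= g4 by exact: gam_ge0.
have g20 : 0 <= g2 by exact: gam_ge0.
have g24 : g2 ^+ 2 <= g4 ^+ 2.
  by apply: lerXn2r; rewrite ?nnegrE // /g2 /g4; apply: gam_le => //; lia.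
have [epp epq eqq] := update_block_error.
rewrite -(ler_pXn2r (ltn0Sn 1)) ?nnegrE ?normF_ge0 ?mulr_ge0 ?sqrtr_ge0 //.
have G20 : 0 <= G2 by exact: sqr_ge0.
have s20 : 0 <= Num.sqrt 2 :> R by exact: sqrtr_ge0.
have H20 : 0 <= normF (Hmx A p q) ^+ 2 by exact: sqr_ge0.
rewrite exprMn /phi [X in _ <= _ * X]sqr_sqrtr; last first.
  by have := mulr_ge0 s20 G20; rewrite -/G2; lra.
have subE i j : (B - T) i j = B i j - T i j by rewrite mxE [X in _ + X]mxE.
have Es i j : (B - T) i j ^+ 2 = (B - T) j i ^+ 2.
  rewrite !subE (sym_entry i j fl_update_sym); congr ((_ - _) ^+ 2).
  exact: (sym_entry i j rotated_sym).
rewrite (sqr_normF (B - T)) (sum_plane_split pq) => [|i j]; last exact: Es.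
rewrite [X in _ + X]big1 ?addr0; last first.
  move=> i /andP[ip iq]; apply: big1 => j /andP[jp jq].
  by rewrite subE (update_outside ip iq jp jq) subrr expr0n.
have rows : \sum_(j | (j != p) && (j != q)) ((B - T) p j ^+ 2 + (B - T) q j ^+ 2) <=
    g4 ^+ 2 * normF (Hmx A p q) ^+ 2.
  rewrite sqr_normF_Hmx // mulrA mulr_sumr; apply: ler_sum => j /andP[jp jq].
  have [ep eq] := update_row_error jp jq; have [Tp Tq] := rotated_row jp jq.
  rewrite Tp in ep; rewrite Tq in eq.
  rewrite !subE Tp Tq; apply: le_trans (rot_row_error cs g20 ep eq) _.
  by rewrite ler_wpM2r ?addr_ge0 ?sqr_ge0 // mulrC ler_wpM2r.
have P0 := mulr_ge0 (sqr_ge0 g4) G20; have sP0 := mulr_ge0 s20 P0.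
rewrite !subE -/G2; move: rows epp epq eqq P0 sP0.
set H := normF (Hmx A p q) ^+ 2; set S := \sum_(j | _) _ => rows epp epq eqq P0 sP0.
have -> : g4 ^+ 2 * ((6 + 4 * Num.sqrt 2) * G2 + 2 * H) =
    6 * (g4 ^+ 2 * G2) + 4 * (Num.sqrt 2 * (g4 ^+ 2 * G2)) + 2 * (g4 ^+ 2 * H).
  ring.
lra.
Qed.

(** The growth factor 1 + 2 g4 applies to |off(A)|^2 - 2 a_pq^2, which is at most
    (1 - 1 / N) |off(A)|^2, and (1 - 1 / N) (1 + 2 g4) <= 1 - 1 / N + 2 g4. *)
Lemma update_off (N : R) :
  max_pivot A p q -> N = ((n * (n - 1)) %/ 2)%:R ->
  normF (off B) ^+ 2 <= (1 - 1 / N + 2 * g4) * normF (off A) ^+ 2 + 2 * G2 * g4 ^+ 2.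
Proof.
move=> [ltpq piv] NE.
have g40 : 0 <= g4 by exact: gam_ge0.
have g20 : 0 <= g2 by exact: gam_ge0.
have n1 : (1 < n)%N by have := ltn_ord q; lia.
have N2 : 2 * N = (n * (n - 1))%:R.
  rewrite NE -natrM; congr _%:R; rewrite mulnC divnK // dvdn2 oddM oddB ?(ltnW n1) //.
  by case: (odd n).
have N0 : 0 < N by have : 0 < 2 * N; [rewrite N2 ltr0n; nia|lra].
have offle : normF (off A) ^+ 2 <= 2 * N * A p q ^+ 2.
  rewrite sqr_normF N2 natrM.
  have row i : \sum_j off A i j ^+ 2 <= (n - 1)%:R * A p q ^+ 2.
    rewrite (bigD1 i) //= off_entry eqxx expr0n add0r.
    have -> : (n - 1)%:R * A p q ^+ 2 = \sum_(j < n | j != i) A p q ^+ 2.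
      by rewrite sumr_const cardC1 card_ord subn1 mulr_natl.
    apply: ler_sum => j ji; rewrite off_entry eq_sym (negPf ji).
    rewrite -(real_normK (num_real (A i j))) -(real_normK (num_real (A p q))).
    by rewrite ler_pXn2r ?nnegrE // piv // eq_sym.
  apply: le_trans (ler_sum _ (fun i _ => row i)) _.
  by rewrite sumr_const card_ord -[leLHS]mulr_natl mulrA.
have [_ epq _] := update_block_error; rewrite rotated_pivot subr0 in epq.
have rest0 : 0 <= \sum_(i | (i != p) && (i != q))
    \sum_(j | (j != p) && (j != q)) off A i j ^+ 2.
  by apply: sumr_ge0 => i _; apply: sumr_ge0 => j _; exact: sqr_ge0.
have restE : \sum_(i | (i != p) && (i != q))
    \sum_(j | (j != p) && (j != q)) off B i j ^+ 2 =
    \sum_(i | (i != p) && (i != q)) \sum_(j | (j != p) && (j != q)) off A i j ^+ 2.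
  apply: eq_bigr => i /andP[ip iq]; apply: eq_bigr => j /andP[jp jq].
  rewrite !off_entry /B mxE.
  by rewrite !(negPf ip) !(negPf iq) !(negPf jp) !(negPf jq).
(* 1 + g4 >= (1 + g2)^2, since g4 counts at least 2 (w + 2) errors. *)
have growth : 1 + 3 * g2 + 2 * g2 ^+ 2 <= 1 + 2 * g4.
  have : gam u ((w + 2) + (w + 2)) <= g4 by apply: gam_le => //; lia.
  have := gamD u (w + 2) (w + 2); rewrite -/g2.
  have -> : (1 + g2) * (1 + g2) = 1 + 2 * g2 + g2 ^+ 2 by ring.
  by move: g20; lra.
have rows : \sum_(j | (j != p) && (j != q)) (B p j ^+ 2 + B q j ^+ 2) <=
    (1 + 2 * g4) * \sum_(j | (j != p) && (j != q)) (A p j ^+ 2 + A q j ^+ 2).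
  rewrite mulr_sumr; apply: ler_sum => j /andP[jp jq].
  have [ep eq] := update_row_error jp jq; have [Tp Tq] := rotated_row jp jq.
  rewrite Tp in ep; rewrite Tq in eq.
  apply: le_trans (rot_row_growth cs g20 ep eq) _.
  by rewrite ler_wpM2r ?addr_ge0 ?sqr_ge0.
have BE := sqr_normF_off fl_update_sym pq; rewrite restE in BE.
have AE := sqr_normF_off As pq.
move: offle rest0 rows epq AE BE; clear restE.
set O := normF (off A) ^+ 2; set O' := normF (off B) ^+ 2.
set X := \sum_(j | _) (A p j ^+ 2 + _); set Y := \sum_(j | _) (B p j ^+ 2 + _).
set S := \sum_(i | _) _.
move=> offle S0 rows epq AE BE.
have NO : O / N <= 2 * A p q ^+ 2.
  by rewrite ler_pdivrMr //; move: offle; rewrite mulrAC.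
have -> : (1 - 1 / N + 2 * g4) * O = O - O / N + 2 * (g4 * O) by rewrite mul1r; ring.
have gO : g4 * O = 2 * (g4 * A p q ^+ 2) + 2 * (g4 * X) + g4 * S by rewrite AE; ring.
have gS := mulr_ge0 g40 S0; have gA := mulr_ge0 g40 (sqr_ge0 (A p q)).
have rows' : Y <= X + 2 * (g4 * X) by move: rows; rewrite mulrDl mul1r mulrA.
have -> : 2 * G2 * g4 ^+ 2 = 2 * (g4 ^+ 2 * G2) by ring.
rewrite BE gO AE; move: epq NO rows' gS gA; rewrite AE; lra.
Qed.

End Step.

(** * Accumulation along the iteration *)

Section Iterates.
Variables (R : realType) (u : R) (fl : fl_model u) (w n : nat).
Hypotheses (u0 : 0 < u) (u1 : u < 1) (w2 : (2 <= w)%N).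
Variables (A : 'M[R]_n) (Ak : nat -> 'M[R]_n) (p q : nat -> 'I_n) (ch sh : nat -> R).
Hypotheses (As : A^T = A) (cj : classical_jacobi w fl A Ak p q ch sh).

Lemma pivot_neq k : p k != q k.
Proof. by have [ltpq _] := cj_pivot cj k; rewrite -(inj_eq val_inj) ltn_eqF. Qed.

Lemma iterate_sym k : (Ak k)^T = Ak k.
Proof.
elim: k => [|k IH]; first by rewrite (cj_init cj).
by rewrite (cj_update cj) fl_update_sym.
Qed.

(** Rotating the previous error by the exact J does not change its norm, so the
    new error is at most the old one plus the error of one step. *)
Lemma iterate_near_similar k : exists2 Q : 'M[R]_n, Q^T *m Q = 1%:M &
  normF (Ak k - Q^T *m A *m Q) <=
  gam u (w * 4) * \sum_(0 <= j < k) phi (Ak j) (p j) (q j).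
Proof.
elim: k => [|k [Q QQ IH]].
  exists 1%:M; first by rewrite trmx1 mulmx1.
  rewrite trmx1 mul1mx mulmx1 (cj_init cj) subrr big_geq // mulr0.
  rewrite /normF big1 ?sqrtr0 // => i _.
  by apply: big1 => j _; rewrite mxE expr0n.
set J := plane_rot (p k) (q k) (jacobi_c (Ak k) (p k) (q k)) (jacobi_s (Ak k) (p k) (q k)).
have JJ : J^T *m J = 1%:M by apply: plane_rot_ortho (pivot_neq k) (jacobi_cs _ _ _).
exists (Q *m J).
  by rewrite trmx_mul mulmxA -(mulmxA J^T) QQ mulmx1.
have -> : Ak k.+1 - (Q *m J)^T *m A *m (Q *m J) =
    (Ak k.+1 - J^T *m Ak k *m J) + J^T *m (Ak k - Q^T *m A *m Q) *m J.
  by rewrite mulmxBr mulmxBl trmx_mul !mulmxA addrA subrK.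
rewrite (le_trans (normF_triangle _ _)) // normF_orthoconj //.
rewrite big_nat_recr //= mulrDr [leRHS]addrC lerD // (cj_update cj).
exact: (update_error fl u0 u1 w2 (iterate_sym k) (pivot_neq k) (cj_rotation cj k)).
Qed.

End Iterates.

(** diag(M) - Q^T A Q = (M - Q^T A Q) - off(M), and Q^T A Q has the eigenvalues of
    A. *)
Lemma diag_near_eigval (R : realType) n (A M Q : 'M[R]_n) :
  A^T = A -> Q^T *m Q = 1%:M ->
  exists pi : 'S_n,
    Num.sqrt (\sum_i (M i i - eigval A (pi i)) ^+ 2) <=
    normF (off M) + normF (M - Q^T *m A *m Q).
Proof.
move=> As QQ.
have Bs : (Q^T *m A *m Q)^T = Q^T *m A *m Q by rewrite !trmx_mul trmxK As mulmxA.
have [pi pi_le] := hoffman_wielandt_diag (fun i => M i i) Bs.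
exists pi.
have eigE i : eigval A i = eigval (Q^T *m A *m Q) i.
  by rewrite /eigval /eigseq char_poly_conj.
under eq_bigr => i _ do rewrite eigE.
apply: (@le_trans _ _ (normF (- off M + (M - Q^T *m A *m Q)))).
  rewrite /normF ler_wsqrtr //.
  rewrite (le_trans pi_le) // le_eqVlt; apply/orP; left; apply/eqP.
  apply: eq_bigr => i _; apply: eq_bigr => j _; congr (_ ^+ 2).
  by rewrite /off opprB addrA subrK [RHS]mxE [X in _ = _ + X]mxE.
apply: le_trans (normF_triangle _ _) _; rewrite lerD2r.
rewrite /normF le_eqVlt; apply/orP; left; apply/eqP; congr Num.sqrt.
by apply: eq_bigr => i _; apply: eq_bigr => j _; rewrite mxE sqrrN.
Qed.

Theorem theorem3p8 (R : realType) :
  exists2 w0 : nat, (0 < w0)%N &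
  forall w : nat, (w0 <= w)%N ->
  forall (u : R) (fl : fl_model u), 0 < u -> u < 1 ->
  forall (n : nat) (A : 'M[R]_n) (Ak : nat -> 'M[R]_n) (p q : nat -> 'I_n)
    (ch sh : nat -> R),
  A^T = A ->
  classical_jacobi w fl A Ak p q ch sh ->
  let N : R := ((n * (n - 1)) %/ 2)%:R in
  let g4 : R := gammat w u 4 in
  let c : R := 1 - 1 / N + 2 * g4 in
  2 * N * g4 < 1 ->
  [/\ 0 < c < 1,
      forall k : nat,
        normF (off (Ak k.+1)) ^+ 2 <=
        c * normF (off (Ak k)) ^+ 2
        + 2 * normF (Gmx (Ak k) (p k) (q k)) ^+ 2 * g4 ^+ 2 &
      forall k : nat, (1 <= k)%N ->
        exists pi : 'S_n,
          Num.sqrt (\sum_i (Ak k i i - eigval (Ak 0%N) (pi i)) ^+ 2) <=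
          normF (off (Ak k))
          + g4 * \sum_(0 <= j < k) phi (Ak j) (p j) (q j)].
Proof.
exists 2%N => // w w2 u fl u0 u1 n A Ak p q ch sh As cj N g4 c Ng4.
have g40 : 0 < g4.
  have w41 : (1 <= w * 4)%N by lia.
  exact: lt_le_trans u0 (le_trans (gam1 u1) (gam_le u0 u1 w41)).
have N1 : 1 <= N.
  have [ltpq _] := cj_pivot cj 0; have ltqn := ltn_ord (q 0%N).
  have n2 : (1 < n)%N by lia.
  by rewrite /N ler1n divn_gt0 // (@leq_mul 2 1) // subn_gt0.
split.
- have N0 : 0 < N := lt_le_trans ltr01 N1.
  have iN1 : 1 / N <= 1 by rewrite ler_pdivrMr // mul1r.
  have iN2 : 2 * g4 < 1 / N by rewrite ltr_pdivlMr // mulrAC.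
  by apply/andP; split; rewrite /c; lra.
- move=> k; rewrite (cj_update cj).
  exact: (update_off fl u0 u1 w2 (iterate_sym As cj k) (pivot_neq cj k)
    (cj_rotation cj k) (cj_pivot cj k) erefl).
move=> k _; have [Q QQ Qk] := iterate_near_similar u0 u1 w2 As cj k.
have [pi pile] := diag_near_eigval (Ak k) As QQ.
exists pi; rewrite (cj_init cj); apply: le_trans pile _.
by rewrite lerD2l.
Qed.
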